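(* Let $d\ge 1$ and let $b\in C^1_\sharp(Y_d)^d$. Define $$\mathscr{I}_b:=\big\{\mu\in\mathscr{M}_p(Y_d):\ \mu\text{ is invariant for the flow } T_t \text{ associated with } b\big\},\qquad C_b:=\left\{\int_{Y_d} b\,d\mu:\ \mu\in\mathscr{I}_b\right\}\subset\mathbb{R}^d.$$ Then $\mathscr{I}_b$ is a nonempty set, and $C_b$ is a nonempty compact convex subset of $\mathbb{R}^d$. Moreover, for any $\zeta\in\mathbb{R}^d$, $$C_b=\{\zeta\}\quad\Longleftrightarrow\quad \forall\,x\in\mathbb{R}^d,\ \ \lim_{t\to\infty}\frac{X(t,x)}{t}=\zeta.$$
   Context: $Y_d:=\mathbb{R}^d/\mathbb{Z}^d$ is the $d$-dimensional torus, identified with the cube $[0,1)^d$. $C^k_\sharp(Y_d)$ is the space of real-valued functions in $C^k(\mathbb{R}^d)$ which are $\mathbb{Z}^d$-periodic. $\mathscr{M}_p(Y_d)$ is the space of (Borel) probability measures on $Y_d$. For $b\in C^1_\sharp(Y_d)^d$ and $x\in\mathbb{R}^d$, $X(\cdot,x)$ denotes the unique solution, defined on all of $\mathbb{R}$ with values in $\mathbb{R}^d$, of $\frac{\partial X}{\partial t}(t,x)=b(X(t,x))$ for $t\in\mathbb{R}$, $X(0,x)=x$. It satisfies $X(t,x+k)=X(t,x)+k$ for $k\in\mathbb{Z}^d$. The associated flow $(T_t)_{t\in\mathbb{R}}$ is $T_t(\varphi)(x):=\varphi(X(t,x))$ for $\varphi\in C^0_\sharp(Y_d)$, $x\in\mathbb{R}^d$.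 A measure $\mu\in\mathscr{M}_p(Y_d)$ is invariant for the flow $T_t$ if for all $t\in\mathbb{R}$ and all $\psi\in C^0_\sharp(Y_d)$, $\int_{Y_d}\psi(X(t,y))\,d\mu(y)=\int_{Y_d}\psi(y)\,d\mu(y)$. *)

(* Defs.v *)
From mathcomp Require Import all_boot all_order all_algebra.
From mathcomp Require Import all_classical all_reals all_analysis.

Set Implicit Arguments.
Unset Strict Implicit.
Unset Printing Implicit Defensive.

Import Order.TTheory GRing.Theory Num.Theory.
Import numFieldNormedType.Exports.

Local Open Scope classical_set_scope.
Local Open Scope ring_scope.

Definition periodic (R : realType) (d : nat) (f : 'rV[R]_d -> R) : Prop :=
  forall (x : 'rV[R]_d) (k : 'rV[int]_d), f (x + map_mx intr k) = f x.

Definition C0_sharp (R : realType) (d : nat) (f : 'rV[R]_d -> R) : Prop :=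
  continuous f /\ periodic f.

Definition C1_sharp (R : realType) (d : nat) (f : 'rV[R]_d -> R) : Prop :=
  C0_sharp f /\
  forall i : 'I_d,
    (forall x : 'rV[R]_d, derivable f x (delta_mx ord0 i)) /\
    continuous (fun x : 'rV[R]_d => 'D_(delta_mx ord0 i) f x).

Definition is_flow (R : realType) (d : nat)
    (b : 'rV[R]_d -> 'rV[R]_d) (X : R -> 'rV[R]_d -> 'rV[R]_d) : Prop :=
  forall x : 'rV[R]_d,
    X 0 x = x /\
    forall t : R, is_derive t (1 : R) (fun s : R => X s x) (b (X t x)).

Notation borelRd R d := (g_sigma_algebraType (@open 'rV[R]_d)).

(* The torus R^d / Z^d is identified with this fundamental domain: the
   bijection from the cube onto the quotient is an isomorphism of Borel
   spaces, so the Borel probability measures on the torus are the Borel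
   probability measures on R^d carried by the cube. *)
Definition cube (R : realType) (d : nat) : set 'rV[R]_d :=
  [set x | forall i : 'I_d, 0 <= x ord0 i < 1].

Definition torus_probability (R : realType) (d : nat) :
    set (probability (borelRd R d) R) :=
  [set mu | mu (@cube R d) = 1%E].

Definition torus_integral (R : realType) (d : nat)
    (mu : probability (borelRd R d) R) (f : 'rV[R]_d -> R) : R :=
  \int[mu]_(x in @cube R d) f x.

Definition torus_vintegral (R : realType) (d : nat)
    (mu : probability (borelRd R d) R) (f : 'rV[R]_d -> 'rV[R]_d) : 'rV[R]_d :=
  \row_i torus_integral mu (fun x => f x ord0 i).

Definition invariant_measures (R : realType) (d : nat)
    (X : R -> 'rV[R]_d -> 'rV[R]_d) : set (probability (borelRd R d) R) :=
  [set mu | torus_probability mu /\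
    forall (t : R) (psi : 'rV[R]_d -> R), C0_sharp psi ->
      torus_integral mu (fun y => psi (X t y)) = torus_integral mu psi].

Definition rotation_set (R : realType) (d : nat)
    (b : 'rV[R]_d -> 'rV[R]_d) (X : R -> 'rV[R]_d -> 'rV[R]_d) :
    set 'rV[R]_d :=
  [set torus_vintegral mu b | mu in invariant_measures X].

(* Main.v *)
From HB Require Import structures.
Require Import Defs.
From mathcomp Require Import all_boot all_order all_algebra.
From mathcomp Require Import all_classical all_reals all_analysis.
From mathcomp Require Import measurable_realfun ring lra.
Import Order.TTheory GRing.Theory Num.Theory.
Import numFieldNormedType.Exports.
Local Open Scope classical_set_scope.
Local Open Scope ring_scope.

Set Implicit Arguments.
Unset Strict Implicit.
Unset Printing Implicit Defensive.

(** The rotation set is studied through functionals. Call state a positive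
    linear functional on the continuous periodic functions with value 1 at 1.
    Integration against a probability measure of the torus is a state, and
    [riesz_representation] says that there are no others: the outer measure of
    the state, built from increasing sequences of continuous functions, is a
    measure on Borel sets by Caratheodory's theorem and represents the state.
    Hence the rotation set consists of the vectors of values taken by the
    invariant states at the components of the field ([rotation_setP]).

    In this form its geometry is immediate. A convex combination of invariant
    states is an invariant state, and so is a pointwise limit of invariant states
    along an ultrafilter; this gives convexity and compactness. Along the orbit
    of any point [x], the time averages on [0, t] are states whose limits along
    ultrafilters finer than [+oo] are invariant, because shifting a long orbit
    segment only affects its ends ([time_average_limit_invariant]); this gives
    nonemptiness. The time average of the field is the mean velocity
    [(X t x - x) / t], so all the limit points of the mean velocities belong to
    the rotation set. If the rotation set is a singleton, the mean velocities,
    which are bounded, must therefore converge to its point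
    ([mean_velocity_cvg]).

    Conversely, if all the mean velocities converge to [zeta] and [mu] is
    invariant, the mean displacement [G t], the integral of [X t y - y], is
    additive in [t]. Its expansion at small times, uniform in [y], gives
    [G 1 = n * G (1 / n)] and hence that [G 1] is the integral of the field; at
    large times [G 1 = G n / n] tends to [zeta] by dominated convergence
    ([rotation_vector_unique]).

    The properties of the flow that are used (group law, commutation with
    integer translations, continuity) come from Gronwall's inequality, since a
    periodic field of class C1 is Lipschitz. *)

(** * Continuous periodic functions *)

Section periodic_functions.
Context {R : realType} {d : nat}.
Implicit Types f g : 'rV[R]_d -> R.

Lemma C0_sharp_cst (c : R) : C0_sharp (fun _ : 'rV[R]_d => c).
Proof. by split=> [|x k //]; exact: cst_continuous. Qed.

Lemma C0_sharpD f g : C0_sharp f -> C0_sharp g -> C0_sharp (fun x => f x + g x).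
Proof.
move=> [cf pf] [cg pg]; split=> [x|x k]; last by rewrite pf pg.
by apply: (@continuousD _ _ _ f g); [exact: cf|exact: cg].
Qed.

Lemma C0_sharpM f g : C0_sharp f -> C0_sharp g -> C0_sharp (fun x => f x * g x).
Proof.
move=> [cf pf] [cg pg]; split=> [x|x k]; last by rewrite pf pg.
by apply: (@continuousM _ _ f g); [exact: cf|exact: cg].
Qed.

Lemma C0_sharpZ (c : R) f : C0_sharp f -> C0_sharp (fun x => c * f x).
Proof. by apply: C0_sharpM; exact: C0_sharp_cst. Qed.

Lemma C0_sharpB f g : C0_sharp f -> C0_sharp g -> C0_sharp (fun x => f x - g x).
Proof.
move=> Cf Cg.
have -> : (fun x => f x - g x) = (fun x => f x + (-1) * g x).
  by apply/funext => x; rewrite mulN1r.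
exact: (C0_sharpD Cf (C0_sharpZ _ Cg)).
Qed.

Lemma C0_sharp_min f g : C0_sharp f -> C0_sharp g ->
  C0_sharp (fun x => Num.min (f x) (g x)).
Proof.
move=> [cf pf] [cg pg]; split=> [x|x k]; last by rewrite pf pg.
exact: (@continuous_min _ _ f g x (cf x) (cg x)).
Qed.

Lemma C0_sharp_sum (I : Type) (r : seq I) (F : I -> 'rV[R]_d -> R) :
  (forall i, C0_sharp (F i)) -> C0_sharp (fun x => \sum_(i <- r) F i x).
Proof.
move=> CF; elim: r => [|i r IH].
  under eq_fun do rewrite big_nil; exact: C0_sharp_cst.
under eq_fun do rewrite big_cons; exact: C0_sharpD.
Qed.

Lemma cube_translate (x : 'rV[R]_d) :
  exists k : 'rV[int]_d, @cube R d (x + map_mx intr k).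
Proof.
exists (\row_i - Num.floor (x ord0 i)) => i; rewrite !mxE.
have /andP[h1 h2] := floor_itv (x ord0 i).
rewrite rmorphN subr_ge0 h1 /= ltrBlDl.
by move: h2; rewrite intrD.
Qed.

Lemma periodic_cube_ind f (P : R -> Prop) : Defs.periodic f ->
  (forall x, @cube R d x -> P (f x)) -> forall x, P (f x).
Proof.
by move=> pf h x; have [k xk] := cube_translate x; rewrite -(pf x k); exact: h.
Qed.

Definition closed_cube : set 'rV[R]_d :=
  [set x | forall i, x ord0 i \in `[0, 1]].

Lemma compact_closed_cube : compact closed_cube.
Proof.
apply: (@rV_compact _ _ (fun=> [set` `[(0 : R), 1]])) => i.
exact: segment_compact.
Qed.

Lemma cube_closed_cube : @cube R d `<=` closed_cube.
Proof.
by move=> x xc i; rewrite in_itv /=; have /andP[-> /ltW ->] := xc i.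
Qed.

Lemma C0_sharp_bounded f : C0_sharp f ->
  exists2 M : R, 0 < M & forall x, `|f x| <= M.
Proof.
move=> [cf pf].
have : compact (f @` closed_cube).
  by apply: continuous_compact compact_closed_cube; exact: continuous_subspaceT.
move=> /compact_bounded [M [_ /(_ (Num.max 1 (M + 1)))]].
have Mlt : M < Num.max 1 (M + 1) by rewrite lt_max ltrDl ltr01 orbT.
move=> /(_ Mlt) fM; exists (Num.max 1 (M + 1)).
  by rewrite lt_max ltr01.
apply: (@periodic_cube_ind f (fun y => `|y| <= Num.max 1 (M + 1)) pf).
by move=> x /cube_closed_cube xc; apply: fM; exists x.
Qed.

End periodic_functions.

(** * States: normalized positive functionals *)

Section states.
Context {R : realType} {d : nat}.
Implicit Types (f g : 'rV[R]_d -> R) (L : ('rV[R]_d -> R) -> R).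

Record state L : Prop := State {
  stateD : forall f g, C0_sharp f -> C0_sharp g ->
    L (fun x => f x + g x) = L f + L g ;
  stateZ : forall c f, C0_sharp f -> L (fun x => c * f x) = c * L f ;
  state_ge0 : forall f, C0_sharp f -> (forall x, 0 <= f x) -> 0 <= L f ;
  state1 : L (fun=> 1) = 1 }.

Variables (L : ('rV[R]_d -> R) -> R) (SL : state L).

Lemma stateB f g : C0_sharp f -> C0_sharp g ->
  L (fun x => f x - g x) = L f - L g.
Proof.
move=> Cf Cg; have -> : (fun x => f x - g x) = (fun x => f x + (-1) * g x).
  by apply/funext => x; rewrite mulN1r.
rewrite (stateD SL Cf (C0_sharpZ _ Cg)) (stateZ SL _ Cg).
by rewrite mulN1r.
Qed.

Lemma state_le f g : C0_sharp f -> C0_sharp g -> (forall x, f x <= g x) ->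
  L f <= L g.
Proof.
move=> Cf Cg fg; rewrite -subr_ge0 -stateB//.
by apply: (state_ge0 SL); [exact: C0_sharpB|move=> x; rewrite subr_ge0].
Qed.

Lemma state_cst c : L (fun=> c) = c.
Proof.
have -> : (fun _ : 'rV[R]_d => c) = (fun=> c * 1) by apply/funext => x; rewrite mulr1.
by rewrite (stateZ SL c (C0_sharp_cst 1)) (state1 SL) mulr1.
Qed.

Lemma state_sum n (F : nat -> 'rV[R]_d -> R) : (forall i, C0_sharp (F i)) ->
  L (fun x => \sum_(0 <= i < n) F i x) = \sum_(0 <= i < n) L (F i).
Proof.
move=> CF; elim: n => [|n IH].
  rewrite big_geq//; under eq_fun do rewrite big_geq//.
  by rewrite state_cst.
rewrite big_nat_recr//= -IH; under eq_fun do rewrite big_nat_recr//=.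
by rewrite (stateD SL)//; exact: C0_sharp_sum.
Qed.

Lemma state_norm_le f M : C0_sharp f -> (forall x, `|f x| <= M) -> `|L f| <= M.
Proof.
move=> Cf fM; rewrite ler_norml -{1}(state_cst (- M)) -{2}(state_cst M).
by apply/andP; split; apply: state_le => //; [exact: C0_sharp_cst| |
  exact: C0_sharp_cst|] => x; have := fM x; rewrite ler_norml => /andP[].
Qed.

End states.

(** A form of Dini's theorem, which is what gives the cube its full mass under
    the outer measure of a state: compactness of the closed cube makes the
    pointwise bound uniform at the cost of [e], and periodicity supplies the
    bound on the faces that the half-open cube lacks. *)
Lemma dini_cube (R : realType) (d : nat) (g : nat -> 'rV[R]_d -> R) (e : R) :
  (forall n, C0_sharp (g n)) -> (forall n x, g n x <= g n.+1 x) ->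
  (forall x, @cube R d x -> exists n, 1 <= g n x) -> 0 < e ->
  exists N, forall x, 1 - e <= g N x.
Proof.
move=> Cg gS g1 e0.
have gle n m x : (n <= m)%N -> g n x <= g m x.
  by move: n m; apply/nondecreasing_seqP => n; exact: gS.
have : near_covering (@closed_cube R d).
  exact/compact_near_coveringP/compact_closed_cube.
move=> /(_ nat \oo (fun n x => 1 - e <= g n x)) [].
  move=> x _; have [k xk] := cube_translate x; have [n0] := g1 _ xk.
  rewrite (Cg n0).2 => gx.
  have : \forall y \near x, 1 - e < g n0 y.
    have := @cvgr_gt _ _ _ (nbhs_filter x) (g n0) (g n0 x) ((Cg n0).1 x) (1 - e). apply.
    by rewrite ltrBlDr (le_lt_trans gx)// ltrDl.
  move=> h; near=> y n => /=.
  have /ltW h' : 1 - e < g n0 y by near: y.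
  by rewrite (le_trans h')//; apply: gle; near: n; exists n0.
move=> N _ /(_ N (leqnn _)) h; exists N.
apply: (@periodic_cube_ind _ _ (g N) (fun y => 1 - e <= y) (Cg N).2) => x xc.
by apply: h; exact: cube_closed_cube.
Unshelve. all: by end_near. Qed.

(** * The outer measure of a state *)

Section outer_measure.
Context {R : realType} {d : nat} (L : ('rV[R]_d -> R) -> R) (SL : state L).
Implicit Types (A : set 'rV[R]_d) (c : R).

(** The part of [A] inside the cube is covered by increasing sequences of
    functions rather than by series: countably many covers then combine into
    one, whose [n]-th term adds up the [n]-th terms of the first [n] covers,
    and no double series appears. *)
Definition dominates A c := exists g : nat -> 'rV[R]_d -> R,
  [/\ forall n, C0_sharp (g n), forall n x, 0 <= g n x,
      forall n x, g n x <= g n.+1 x,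
      forall x, A x -> @cube R d x -> exists n, 1 <= g n x &
      forall n, L (g n) <= c].

Definition outer A : R := inf (dominates A).

Lemma dominates_single A f : C0_sharp f -> (forall x, 0 <= f x) ->
  (forall x, A x -> 1 <= f x) -> dominates A (L f).
Proof. by move=> Cf f0 f1; exists (fun=> f); split=> // x /f1; exists 0%N. Qed.

Lemma dominates_ge0 A c : dominates A c -> 0 <= c.
Proof. by move=> [g [Cg g0 _ _ /(_ 0%N)]]; apply: le_trans; exact: (state_ge0 SL). Qed.

Lemma has_inf_dominates A : has_inf (dominates A).
Proof.
split; last by exists 0 => c /dominates_ge0.
by exists (L (fun=> 1)); apply: dominates_single => //; exact: C0_sharp_cst.
Qed.

Lemma outer_le A c : dominates A c -> outer A <= c.
Proof. by move=> Ac; apply: ge_inf => //; have [] := has_inf_dominates A. Qed.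

Lemma outer_ge0 A : 0 <= outer A.
Proof.
apply: lb_le_inf; first by have [] := has_inf_dominates A.
by move=> c /dominates_ge0.
Qed.

Lemma outer_adherent A e : 0 < e -> exists2 c, dominates A c & c < outer A + e.
Proof. by move=> e0; apply: inf_adherent => //; exact: has_inf_dominates. Qed.

Lemma outer_le1 A : outer A <= 1.
Proof.
rewrite -(state1 SL); apply: outer_le; apply: dominates_single => //.
exact: C0_sharp_cst.
Qed.

Lemma outer_cube1 A : @cube R d `<=` A -> outer A = 1.
Proof.
move=> cA; apply/eqP; rewrite eq_le outer_le1/=.
apply: lb_le_inf; first by have [] := has_inf_dominates A.
move=> c [g [Cg g0 gS g1 gc]]; apply/ler_addgt0Pr => e e0.
have [N hN] := dini_cube Cg gS (fun x xc => g1 x (cA x xc) xc) e0.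
rewrite -lerBlDr -(state_cst SL (1 - e)) (le_trans _ (gc N))//.
by apply: state_le => //; exact: C0_sharp_cst.
Qed.

(** The zero sequence already covers a set which misses the cube; hence the
    representing measure is carried by the cube. *)
Lemma outer_disjoint_cube A : A `&` @cube R d = set0 -> outer A = 0.
Proof.
move=> A0; apply/eqP; rewrite eq_le outer_ge0 andbT.
rewrite -(state_cst SL 0); apply: outer_le.
exists (fun _ _ => 0); split=> //.
- by move=> _; exact: C0_sharp_cst.
- by move=> x Ax cx; have : (A `&` @cube R d) x by []; rewrite A0.
Qed.

(** Only partial sums occur, so that real arithmetic suffices: [S] stands for
    the sum of the series when it is finite. *)
Lemma outer_sigma_subadditive A (F : nat -> set 'rV[R]_d) (e S : R) :
  A `<=` \bigcup_n F n -> (forall n, \sum_(0 <= i < n) outer (F i) <= S) ->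
  0 < e -> outer A <= S + e.
Proof.
move=> AF FS e0.
have /choice[g gP] i : exists g : nat -> 'rV[R]_d -> R,
  [/\ forall n, C0_sharp (g n), forall n x, 0 <= g n x,
      forall n x, g n x <= g n.+1 x,
      forall x, F i x -> @cube R d x -> exists n, 1 <= g n x &
      forall n, L (g n) <= outer (F i) + e / 2 ^+ i.+1].
  have ei : 0 < e / 2 ^+ i.+1 by rewrite divr_gt0// exprn_gt0.
  have [c [g [Cg g0 gS g1 gc]] cF] := outer_adherent (F i) ei.
  by exists g; split=> // n; rewrite (le_trans (gc n))// ltW.
have gle i n m x : (n <= m)%N -> g i n x <= g i m x.
  have [_ _ gS _ _] := gP i.
  by move: n m; apply/nondecreasing_seqP => n; exact: gS.
apply: outer_le; exists (fun n x => \sum_(0 <= i < n) g i n x); split.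
- by move=> n; apply: C0_sharp_sum => i; have [] := gP i.
- by move=> n x; apply: sumr_ge0 => i _; have [] := gP i.
- move=> n x; rewrite big_nat_recr//= -[leLHS]addr0 lerD//.
    by apply: ler_sum => i _; exact: gle.
  by have [_ /(_ n.+1 x)] := gP n.
- move=> x /AF [i _ Fix] cx; have [_ _ _ /(_ x Fix cx)[n gn] _] := gP i.
  exists (maxn i.+1 n); rewrite (bigD1_seq i)/= ?iota_uniq//; last first.
    by rewrite mem_index_iota/= leq_maxl.
  rewrite -[leLHS]addr0 lerD//.
    by rewrite (le_trans gn)// gle// leq_maxr.
  by apply: sumr_ge0 => j _; have [] := gP j.
- move=> n; rewrite (state_sum SL); last by move=> i; have [] := gP i.
  have geo k : \sum_(0 <= i < k) (e / 2 ^+ i.+1) = e - e / 2 ^+ k.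
    elim: k => [|k IH]; first by rewrite big_geq// expr0 divr1 subrr.
    rewrite big_nat_recr//= IH exprS invfM.
    have : 2 ^+ k != 0 :> R by rewrite expf_neq0.
    by move=> k0; field.
  apply: (@le_trans _ _ (\sum_(0 <= i < n) (outer (F i) + e / 2 ^+ i.+1))).
    by apply: ler_sum => i _; have [] := gP i.
  rewrite big_split/= geo lerD// lerBlDr lerDl divr_ge0// ?ltW//.
Qed.

End outer_measure.

(** * Coordinatewise convergence *)

Lemma cvg_row (R : realFieldType) (d : nat) (T : Type) (F : set_system T)
    {FF : Filter F} (f : T -> 'rV[R]_d) (l : 'rV[R]_d) :
  (forall i, f t ord0 i @[t --> F] --> l ord0 i) -> f @ F --> l.
Proof.
move=> fl; apply/cvg_ballP => e e0.
have : \forall t \near F, forall i : 'I_d, ball (l ord0 i) e (f t ord0 i).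
  by apply: filter_forall => i; move/cvg_ballP : (fl i); exact.
apply: filterS => t h; split => // i j.
by rewrite (ord1 i).
Qed.

(** * Collapsing the space onto the cube *)

Section collapse.
Context {R : realType}.

(** This approximates the identity of [0, 1) from below by continuous functions
    vanishing at both ends of the interval, hence with continuous periodic
    extensions. *)
Definition tent (n : nat) (s : R) : R := Num.max 0 (Num.min s (n%:R * (1 - s))).

(** A one-dimensional periodic continuous substitute for the fractional part,
    with which it agrees on the first [n / (n + 1)] of each period. *)
Definition sawtooth (n : nat) (s : R) : R := tent n (s - (Num.floor s)%:~R).

Lemma tent_le0 n s : s <= 0 -> tent n s = 0.
Proof. by move=> s0; apply/max_l; rewrite ge_min s0. Qed.

Lemma tent_ge1 n s : 1 <= s -> tent n s = 0.
Proof.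
move=> s1; apply/max_l; rewrite ge_min; apply/orP; right.
by rewrite mulr_ge0_le0// subr_le0.
Qed.

Lemma continuous_tent n : continuous (tent n).
Proof.
move=> s; apply: (@continuous_max _ _ (fun=> 0) _ s); first exact: cst_continuous.
apply: (@continuous_min _ _ id (fun s => n%:R * (1 - s)) s) => //.
apply: cvgM; first exact: cvg_cst.
by apply: cvgB; [exact: cvg_cst|exact: cvg_id].
Qed.

Lemma sawtoothDz n s (k : int) : sawtooth n (s + k%:~R) = sawtooth n s.
Proof.
rewrite /sawtooth; have -> : Num.floor (s + k%:~R) = Num.floor s + k.
  apply: floor_def; have /andP[h1 h2] := floor_itv s.
  by move: h1 h2; rewrite !intrD => h1 h2; apply/andP; split; lra.
by rewrite intrD; congr tent; ring.
Qed.

(** Across an integer two consecutive periods add up, which reduces the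
    continuity of the sawtooth at integers to that of the tent. *)
Lemma sawtoothE n s (m : int) : m%:~R - 1 <= s < m%:~R + 1 ->
  sawtooth n s = tent n (s - m%:~R) + tent n (s - (m%:~R - 1)).
Proof.
move=> /andP[s1 s2]; rewrite /sawtooth.
have [ms|sm] := leP m%:~R s.
  have -> : Num.floor s = m by apply: floor_def; rewrite ms intrD.
  by rewrite (@tent_ge1 _ (s - (m%:~R - 1))) ?addr0//; lra.
have -> : Num.floor s = m - 1.
  by apply: floor_def; rewrite subrK sm intrD rmorphN/= s1.
by rewrite (@tent_le0 _ (s - m%:~R)) ?add0r; [rewrite intrD rmorphN|lra].
Qed.

Lemma continuous_sawtooth n : continuous (sawtooth n).
Proof.
move=> s; set m := Num.floor s.
have /andP[h1 h2] := floor_itv s; rewrite intrD in h2.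
have sE : \forall r \near s,
    tent n (r - m%:~R) + tent n (r - (m%:~R - 1)) = sawtooth n r.
  near=> r; rewrite (@sawtoothE n r m)//; apply/andP; split.
    by apply: ltW; near: r; apply: lt_nbhsr; rewrite /m; lra.
  by near: r; apply: lt_nbhsl; rewrite /m; lra.
have ct (c : R) : {for s, continuous (fun r => tent n (r - c))}.
  apply: (@continuous_comp _ _ _ (fun r => r - c) (tent n)).
    by apply: cvgB; [exact: cvg_id|exact: cvg_cst].
  exact: continuous_tent.
rewrite /continuous_at (@sawtoothE n s m); last by rewrite /m; lra.
apply: cvg_trans; first exact: (near_eq_cvg sE).
exact: (cvgD (ct _) (ct _)).
Unshelve. all: by end_near. Qed.

Lemma sawtooth_id s : 0 <= s < 1 -> \forall n \near \oo, sawtooth n s = s.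
Proof.
move=> /andP[s0 s1].
have fs : Num.floor s = 0 by apply: floor_def; rewrite s0/= s1.
have s1' : 0 < 1 - s by rewrite subr_gt0.
near=> n; rewrite /sawtooth fs subr0 /tent.
have -> : Num.min s (n%:R * (1 - s)) = s.
  apply/min_l; rewrite -ler_pdivrMr//.
  by near: n; exact: nbhs_infty_ger.
exact/max_r.
Unshelve. all: by end_near. Qed.

Variable d : nat.

Definition collapse (n : nat) (x : 'rV[R]_d) : 'rV[R]_d :=
  \row_i sawtooth n (x ord0 i).

Lemma continuous_collapse n : continuous (collapse n).
Proof.
move=> x; apply: (@cvg_row _ _ _ (nbhs x) (nbhs_filter x)) => i.
rewrite !mxE; under eq_fun do rewrite mxE.
apply: (@continuous_comp _ _ _ (fun y : 'rV[R]_d => y ord0 i) (sawtooth n)).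
  exact: coord_continuous.
exact: continuous_sawtooth.
Qed.

Lemma C0_sharp_comp_collapse n (h : 'rV[R]_d -> R) :
  continuous h -> C0_sharp (h \o collapse n).
Proof.
move=> ch; split=> [x|x k /=].
  by apply: continuous_comp; [exact: continuous_collapse|exact: ch].
by congr h; apply/rowP => i; rewrite !mxE sawtoothDz.
Qed.

(** The half-open cube is not closed, so no continuous map retracts the space
    onto it; each of its points is however fixed by all but finitely many of the
    collapsing maps. *)
Lemma collapse_id x : @cube R d x -> \forall n \near \oo, collapse n x = x.
Proof.
move=> cx; have : \forall n \near \oo, forall i, sawtooth n (x ord0 i) = x ord0 i.
  by apply: filter_forall => i; apply: sawtooth_id; exact: cx.
by apply: filterS => n h; apply/rowP => i; rewrite mxE.
Qed.

End collapse.

(** The witness is the distance to the complement of [U], truncated at 1 so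
    that it remains an infimum over a nonempty set when [U] is the whole
    space. *)
Lemma open_positivity_set (R : realType) (V : normedModType R) (U : set V) :
  open U -> exists h : V -> R,
    [/\ continuous h, forall y, 0 <= h y & forall y, 0 < h y <-> U y].
Proof.
move=> oU; pose D y := [set r : R | r = 1 \/ exists2 z, ~ U z & r = `|y - z|].
have D0 y : D y !=set0 by exists 1; left.
have Dlb y : has_lbound (D y).
  by exists 0 => _ [->//|[z _ ->]].
pose h y := inf (D y).
have h_ge0 y : 0 <= h y by apply: lb_le_inf => // _ [->//|[z _ ->]].
have lip y y' : h y <= h y' + `|y - y'|.
  rewrite -lerBlDr; apply: lb_le_inf => // _ [->|[z Uz ->]].
    rewrite lerBlDr; apply: (@le_trans _ _ 1); last by rewrite lerDl.
    by apply: ge_inf => //; left.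
  rewrite lerBlDr; apply: (@le_trans _ _ `|y - z|).
    by apply: ge_inf => //; right; exists z.
  by rewrite [leRHS]addrC -(subrKA y' y (- z)) ler_normD.
exists h; split => //.
- move=> y; apply/cvgrPdist_le => e e0; near=> y'.
  have : `|y - y'| <= e by near: y'; exact: cvgr_dist_le.
  have := lip y y'; have := lip y' y; rewrite (distrC y' y) => h1 h2 h3.
  by rewrite ler_distl; apply/andP; split; lra.
- move=> y; split=> [hy|Uy].
    apply: contrapT => Uy; have : h y <= 0; last by rewrite leNgt hy.
    by apply: ge_inf => //; right; exists y => //; rewrite subrr normr0.
  have /nbhs_ballP[e /= e0 eU] : nbhs y U by exact: open_nbhs_nbhs.
  apply: (@lt_le_trans _ _ (Num.min 1 e)); first by rewrite lt_min ltr01.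
  apply: lb_le_inf => // _ [->|[z Uz ->]]; first by rewrite ge_min lexx.
  rewrite ge_min; apply/orP; right; rewrite leNgt; apply/negP => yz.
  by apply: Uz; apply: eU; rewrite -ball_normE.
Unshelve. all: by end_near. Qed.

(** * The representing measure of a state *)

Section representing_measure.
Context {R : realType} {d : nat} (L : ('rV[R]_d -> R) -> R) (SL : state L).

Definition eouter (A : set 'rV[R]_d) : \bar R := (outer L A)%:E.

Lemma eouter0 : eouter set0 = 0%E.
Proof. by rewrite /eouter (outer_disjoint_cube SL)// set0I. Qed.

Lemma eouter_ge0 A : (0 <= eouter A)%E.
Proof. by rewrite lee_fin; exact: outer_ge0. Qed.

Lemma eouter_sigma_subadditive A F : subset_sigma_subadditive eouter A F.
Proof.
move=> AF; have s0 n : (0 <= eouter (F n))%E by exact: eouter_ge0.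
have [->|] := eqVneq (\sum_(i <oo) eouter (F i))%E +oo%E; first by rewrite leey.
rewrite -ltey => Sfin.
have /fineK SE : (\sum_(i <oo) eouter (F i))%E \is a fin_num.
  by rewrite ge0_fin_numE// nneseries_ge0.
rewrite -SE; apply/lee_addgt0Pr => e e0; rewrite -EFinD lee_fin.
apply: (outer_sigma_subadditive SL AF _ e0) => n.
rewrite -lee_fin SE -sumEFin.
exact: (nneseries_lim_ge (P := xpredT) n (fun k _ _ => s0 k)).
Qed.

HB.instance Definition _ := isSubsetOuterMeasure.Build R 'rV[R]_d eouter
  eouter0 eouter_ge0 eouter_sigma_subadditive.

Notation M := (caratheodory_measurable eouter).

(** The truncations [min 1 (k * phi)] increase to the indicator of the
    positivity set [P]. Multiplying a cover of [X] by them gives a cover of the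
    part of [X] in [P]; multiplying by the complement of a single, late,
    truncation covers the rest, and the two costs add up to that of the
    initial cover. *)
Lemma caratheodory_positivity_set (phi : 'rV[R]_d -> R) : C0_sharp phi ->
  (forall x, 0 <= phi x) -> M [set x | 0 < phi x].
Proof.
move=> Cphi phi0; set P := [set x | 0 < phi x].
apply: le_caratheodory_measurable => X; rewrite -EFinD lee_fin.
apply: lb_le_inf; first by have [] := has_inf_dominates SL X.
move=> c [g [Cg g0 gS g1 gc]].
pose t (k : nat) x := Num.min 1 (k%:R * phi x).
have Ct k : C0_sharp (t k).
  exact: (C0_sharp_min (C0_sharp_cst 1) (C0_sharpZ k%:R Cphi)).
have t0 k x : 0 <= t k x by rewrite le_min ler01 mulr_ge0.
have t1 k x : t k x <= 1 by rewrite ge_min lexx.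
have tS k x : t k x <= t k.+1 x.
  by rewrite le_min t1 ge_min ler_wpM2r ?orbT// ler_nat.
have tP x : P x -> exists N, forall k, (N <= k)%N -> t k x = 1.
  rewrite /P /= => px; have [N _ hN] := nbhs_infty_ger (phi x)^-1.
  exists N => k /hN /= Nk; apply/min_l.
  by rewrite -ler_pdivrMr// mul1r.
have tN x k : ~ P x -> t k x = 0.
  move=> /negP; rewrite -leNgt /t => p0.
  have -> : phi x = 0 by apply/eqP; rewrite eq_le p0 phi0.
  by rewrite mulr0; exact/min_r.
have gle n m x : (n <= m)%N -> g n x <= g m x.
  by move: n m; apply/nondecreasing_seqP => n; exact: gS.
have tle n m x : (n <= m)%N -> t n x <= t m x.
  by move: n m; apply/nondecreasing_seqP => n; exact: tS.
pose h n x := g n x * t n x.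
have Ch n : C0_sharp (h n) by exact: C0_sharpM.
have Lhc n : L (h n) <= c.
  apply: le_trans (gc n); apply: state_le => // x.
  by rewrite ler_piMr.
pose s := sup (range (fun n => L (h n))).
have hs : has_sup (range (fun n => L (h n))).
  by split; [exists (L (h 0%N)), 0%N|exists c => _ [n _ <-]].
have Ls n : L (h n) <= s by apply: sup_upper_bound => //; exists n.
have XP : outer L (X `&` P) <= s.
  apply: (outer_le SL); exists h; split=> //.
  - by move=> n x; rewrite mulr_ge0.
  - by move=> n x; rewrite ler_pM.
  - move=> x [Xx Px] cx; have [n gn] := g1 x Xx cx; have [N tN1] := tP x Px.
    exists (maxn n N); rewrite /h tN1 ?leq_maxr// mulr1.
    by rewrite (le_trans gn)// gle// leq_maxl.
apply/ler_addgt0Pr => e e0.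
have [_ [k _ <-] sk] := sup_adherent e0 hs.
suff XN : outer L (X `&` ~` P) <= c - L (h k).
  by move: XP XN sk; rewrite -/s; lra.
apply: (outer_le SL); exists (fun n x => g n x * (1 - t k x)).
have t1' x : 0 <= 1 - t k x by rewrite subr_ge0.
have Cq n : C0_sharp (fun x => g n x * (1 - t k x)).
  by apply: C0_sharpM => //; apply: C0_sharpB => //; exact: C0_sharp_cst.
split=> //.
- by move=> n x; rewrite mulr_ge0.
- by move=> n x; rewrite ler_wpM2r.
- move=> x [Xx Px] cx; have [n gn] := g1 x Xx cx.
  by exists n; rewrite tN// subr0 mulr1.
move=> n; pose m := maxn n k.
apply: (@le_trans _ _ (L (fun x => g m x * (1 - t k x)))).
  by apply: state_le => // x; rewrite ler_wpM2r// gle// leq_maxl.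
have -> : (fun x => g m x * (1 - t k x)) = (fun x => g m x - g m x * t k x).
  by apply/funext => x; rewrite mulrBr mulr1.
have Cgt : C0_sharp (fun x => g m x * t k x) by exact: C0_sharpM.
rewrite (stateB SL)// lerB//.
by apply: state_le => // x; rewrite ler_wpM2r// gle// leq_maxr.
Qed.

(** Such sets are null by [outer_disjoint_cube]. *)
Lemma caratheodory_disjoint_cube A : A `&` @cube R d = set0 -> M A.
Proof.
move=> A0; apply: le_caratheodory_measurable => X.
have e0 : eouter (X `&` A) = 0%E.
  by rewrite /eouter (outer_disjoint_cube SL)// -setIA A0 setI0.
rewrite -[leLHS]/(eouter (X `&` A) + eouter (X `&` ~` A))%E e0 add0e.
by apply: le_outer_measure => x [].
Qed.

(** Up to a null set outside the cube, an open set is the lower limit of its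
    preimages by the collapsing maps, which are open and periodic. *)
Lemma caratheodory_open U : open U -> M U.
Proof.
move=> oU; have [h [ch h0 hU]] := open_positivity_set oU.
pose V n := [set x | 0 < h (collapse n x)].
have MV n : M (V n).
  by apply: (@caratheodory_positivity_set (h \o collapse n)) => [|x /=];
    [exact: C0_sharp_comp_collapse|exact: h0].
have Mcap (F : nat -> set 'rV[R]_d) : (forall n, M (F n)) -> M (\bigcap_n F n).
  move=> MF; rewrite -[\bigcap_n _]setCK setC_bigcap.
  apply: caratheodory_measurable_setC; apply: caratheodory_measurable_bigcup => n.
  exact: caratheodory_measurable_setC.
have Mcube : M (@cube R d).
  rewrite -[@cube R d]setCK; apply: caratheodory_measurable_setC.
  by apply: caratheodory_disjoint_cube; rewrite setICl.
pose W := \bigcup_N \bigcap_n V (N + n)%N.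
have -> : U = (W `&` @cube R d) `|` (U `&` ~` @cube R d).
  rewrite -{1}(setIT U) -(setUv (@cube R d)) setIUr; congr (_ `|` _).
  apply/seteqP; split=> [x [Ux cx]|x [[N _ Vx] cx]]; split=> //.
    have [N _ hN] := collapse_id cx; exists N => // n _.
    by rewrite /V /= hN ?hU//=; exact: leq_addr.
  have [N' _ hN'] := collapse_id cx.
  have := Vx N' I; rewrite /V /= hN' ?hU//=; exact: leq_addl.
apply: caratheodory_measurable_setU.
  apply: caratheodory_measurable_setI => //.
  by apply: caratheodory_measurable_bigcup => N; exact: Mcap.
by apply: caratheodory_disjoint_cube; rewrite -setIA setICl setI0.
Qed.

Lemma caratheodory_borel (A : set (borelRd R d)) : measurable A -> M A.
Proof.
move=> mA; apply: (mA M); split; last exact: caratheodory_open.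
split.
- exact: caratheodory_measurable_set0.
- by move=> B MB; rewrite setTD; exact: caratheodory_measurable_setC.
- exact: caratheodory_measurable_bigcup.
Qed.

Definition state_measure (A : set (borelRd R d)) : \bar R := eouter A.

Let state_measure0 : state_measure set0 = 0%E. Proof. exact: eouter0. Qed.

Let state_measure_ge0 A : (0 <= state_measure A)%E. Proof. exact: eouter_ge0. Qed.

Let state_measure_sigma_additive : semi_sigma_additive state_measure.
Proof.
move=> F mF tF mUF.
apply: (@caratheodory_measure_sigma_additive R 'rV[R]_d eouter F) => //.
  by move=> i; exact: caratheodory_borel.
exact: caratheodory_borel.
Qed.

HB.instance Definition _ := isMeasure.Build _ _ _ state_measure
  state_measure0 state_measure_ge0 state_measure_sigma_additive.

Let state_measure_setT : state_measure setT = 1%E.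
Proof. by rewrite /state_measure /eouter (outer_cube1 SL). Qed.

HB.instance Definition _ :=
  Measure_isProbability.Build _ _ _ state_measure state_measure_setT.

Lemma state_probability : exists mu : probability (borelRd R d) R,
  forall A, mu A = (outer L A)%:E.
Proof. by exists state_measure. Qed.

End representing_measure.

(** * Integration on the torus and the Riesz representation *)

Section torus_integration.
Context {R : realType} {d : nat}.
Implicit Types (f g : 'rV[R]_d -> R).

Lemma continuous_measurable_borel (D : set (borelRd R d)) f :
  continuous f -> measurable_fun D f.
Proof.
move=> cf; apply: measurable_funS (@subsetT _ D) _ => //.
apply: (measurability _ (RGenOInfty.measurableE R)) => _ [_ [a ->] <-].
rewrite setTI; apply: sub_sigma_algebra.
by apply: open_comp => [x _|]; [exact: cf|exact: interval_open].
Qed.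

Lemma measurable_cube : measurable (@cube R d : set (borelRd R d)).
Proof.
have -> : @cube R d = \bigcap_(i in [set: 'I_d])
    (fun x : 'rV[R]_d => x ord0 i) @^-1` [set` `[(0 : R), 1[].
  apply/seteqP; split=> x h i; first by move=> _; rewrite /= in_itv/=; exact: h.
  by have := h i I; rewrite /= in_itv.
apply: fin_bigcap_measurable => // i _; rewrite -[X in measurable X]setTI.
by apply: continuous_measurable_borel => //; exact: coord_continuous.
Qed.

Variable mu : probability (borelRd R d) R.

Lemma C0_sharp_integrable f : C0_sharp f -> mu.-integrable (@cube R d) (EFin \o f).
Proof.
move=> Cf; apply: measurable_bounded_integrable.
- exact: measurable_cube.
- by rewrite (le_lt_trans (probability_le1 _ measurable_cube))// ltry.
- exact: continuous_measurable_borel Cf.1.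
- have [M M0 fM] := C0_sharp_bounded Cf.
  exists M; split; first exact: num_real.
  by move=> r Mr x _; apply: (le_trans (fM x)); exact: ltW.
Qed.

Lemma torus_integral_state : torus_probability mu -> state (torus_integral mu).
Proof.
move=> mu1; split.
- move=> f g Cf Cg.
  exact: (RintegralD measurable_cube (C0_sharp_integrable Cf)
    (C0_sharp_integrable Cg)).
- move=> c f Cf; exact: (RintegralZl c measurable_cube (C0_sharp_integrable Cf)).
- by move=> f Cf f0; apply: Rintegral_ge0.
- rewrite /torus_integral (Rintegral_cst mu measurable_cube).
  by rewrite [X in fine X](mu1 : _ = 1%E) mul1r.
Qed.

Lemma torus_integral_le_measure f (A : set (borelRd R d)) : C0_sharp f -> measurable A ->
  (forall x, 0 <= f x) -> (forall x, f x <= \1_A x) ->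
  ((torus_integral mu f)%:E <= mu A)%E.
Proof.
move=> Cf mA f0 fA.
have If := C0_sharp_integrable Cf.
rewrite /torus_integral /Rintegral fineK; last first.
  exact: (integrable_fin_num measurable_cube If).
apply: (@le_trans _ _ (\int[mu]_(x in @cube R d) (\1_A x)%:E)%E).
  apply: ge0_le_integral; first exact: measurable_cube.
  - by move=> x _; rewrite lee_fin.
  - exact: (measurable_int _ If).
  - by apply/measurable_EFinP; exact: measurable_indic.
  - by move=> x _; rewrite lee_fin.
rewrite integral_indic//; last exact: measurable_cube.
apply: le_measure => //; rewrite ?inE//.
exact: measurableI mA measurable_cube.
Qed.

End torus_integration.

Section riesz.
Context {R : realType} {d : nat}.
Implicit Types (f g : 'rV[R]_d -> R).

(** Both states take the value 1 at 1, so an inequality between them on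
    functions with values in [0, 1] is reversed by passing to [1 - f]. *)
Lemma state_eq (L I : ('rV[R]_d -> R) -> R) : state L -> state I ->
  (forall f, C0_sharp f -> (forall x, 0 <= f x <= 1) -> I f <= L f) ->
  forall f, C0_sharp f -> I f = L f.
Proof.
move=> SL SI IL.
have eq01 f : C0_sharp f -> (forall x, 0 <= f x <= 1) -> I f = L f.
  move=> Cf f01; apply/eqP; rewrite eq_le IL//=.
  have C1 : C0_sharp (fun _ : 'rV[R]_d => 1 : R) by exact: C0_sharp_cst.
  have := IL _ (C0_sharpB C1 Cf).
  rewrite (stateB SI)// (stateB SL)// (state1 SI) (state1 SL) lerD2l lerN2.
  by apply=> x; have /andP[? ?] := f01 x; apply/andP; split; lra.
move=> f Cf; have [M M0 fM] := C0_sharp_bounded Cf.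
pose h x := (2 * M)^-1 * (f x + M).
have M2 : 0 < 2 * M by rewrite mulr_gt0.
have CM : C0_sharp (fun _ : 'rV[R]_d => M) by exact: C0_sharp_cst.
have Ch : C0_sharp h by apply: C0_sharpZ; exact: C0_sharpD.
have hE S : state S -> S h = (2 * M)^-1 * (S f + M).
  move=> SS; rewrite (stateZ SS); last exact: C0_sharpD.
  by rewrite (stateD SS)// (state_cst SS).
have := eq01 h Ch; rewrite (hE _ SI) (hE _ SL) => hIL.
have {}hIL : (2 * M)^-1 * (I f + M) = (2 * M)^-1 * (L f + M).
  apply: hIL => x; rewrite /h mulrC ler_pdivlMr// ler_pdivrMr// mul0r mul1r.
  by have := fM x; rewrite ler_norml => /andP[? ?]; apply/andP; split; lra.
apply: (addIr M); apply: mulfI hIL.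
by rewrite invr_eq0 gt_eqF.
Qed.

(** Slicing [f] horizontally into [n] layers of height [1 / n], the [i]-th
    rescaled layer lies between the indicators of [f > (i + 1) / n]
    and [f > i / n]. The integral of a layer is thus controlled by the measure of
    its support, hence by the value of the state at the layer just below; only the lowest
    layer is lost, at a cost of [1 / n]. *)
Theorem riesz_representation (L : ('rV[R]_d -> R) -> R) : state L ->
  exists2 mu : probability (borelRd R d) R, torus_probability mu &
    forall f, C0_sharp f -> torus_integral mu f = L f.
Proof.
move=> SL; have [mu muE] := state_probability SL.
have mu1 : torus_probability mu.
  by rewrite /torus_probability /= muE (outer_cube1 SL).
exists mu => //; have SI := torus_integral_state mu1.
apply: state_eq => // f Cf f01; set I := torus_integral mu in SI *.
apply/ler_addgt0Pr => e e0.
have [n n0 en] : exists2 n : nat, (0 < n)%N & n%:R^-1 <= e.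
  have [N _ hN] := nbhs_infty_ger e^-1; exists N.+1 => //.
  rewrite -[leRHS]invrK lef_pV2 ?posrE ?invr_gt0//.
  by apply: hN => /=.
have n0' : 0 < n%:R :> R by rewrite ltr0n.
apply: (@le_trans _ _ (L f + n%:R^-1)); last by rewrite lerD2l.
pose c (i : nat) : R := i%:R / n%:R.
pose cut i x := Num.min (f x) (c i).
pose u i x := n%:R * (cut i.+1 x - cut i x).
pose P i := [set x | c i < f x].
have ccS i : c i.+1 = c i + n%:R^-1 by rewrite /c -natr1 mulrDl mul1r.
have Ccut i : C0_sharp (cut i) by apply: C0_sharp_min => //; exact: C0_sharp_cst.
have Cu i : C0_sharp (u i) by apply: C0_sharpZ; exact: C0_sharpB.
have iv0 : 0 < n%:R^-1 :> R by rewrite invr_gt0.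
have u0 i x : 0 <= u i x.
  rewrite mulr_ge0// subr_ge0 /cut le_min ge_min lexx/= ge_min.
  by rewrite ccS lerDl (ltW iv0) orbT.
have uP i x : u i x <= \1_(P i) x.
  rewrite indicE; have [xP|xP] := boolP (x \in P i).
    rewrite /= mulr1n /u -ler_pdivlMl// mulr1 /cut ccS.
    move: xP; rewrite inE /P /= => cf.
    rewrite (min_r (ltW cf)) lerBlDl.
    by rewrite ge_min lexx orbT.
  have fc : f x <= c i.
    by rewrite leNgt; apply/negP => h; move: xP; rewrite notin_setE; exact.
  by rewrite /= /u /cut !min_l// ?subrr ?mulr0// (le_trans fc)// ccS lerDl ltW.
have PuS i x : P i.+1 x -> 1 <= u i x.
  rewrite /P /= => cf; rewrite /u /cut (min_r (ltW cf)) min_r; last first.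
    by rewrite (le_trans _ (ltW cf))// ccS lerDl ltW.
  by rewrite ccS addrAC subrr add0r divff// gt_eqF.
have mP i : measurable (P i : set (borelRd R d)).
  apply: sub_sigma_algebra; rewrite (_ : P i = f @^-1` `]c i, +oo[); last first.
    by apply/seteqP; split => x /=; rewrite in_itv/= andbT.
  by apply: open_comp => [x _|]; [exact: Cf.1|exact: interval_open].
have Iu i : I (u i) <= outer L (P i).
  by rewrite -lee_fin -muE; apply: torus_integral_le_measure.
have uL i : outer L (P i.+1) <= L (u i).
  apply: (outer_le SL);
  exact: (@dominates_single _ _ L (P i.+1) (u i) (Cu i) (u0 i) (@PuS i)).
have fE : (fun x => n%:R * f x) = fun x => \sum_(0 <= i < n) u i x.
  apply/funext => x; rewrite -mulr_sumr telescope_sumr//.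
  rewrite /cut /c divff ?gt_eqF// mul0r; have /andP[f0 f1] := f01 x.
  by rewrite (min_l f1) (min_r f0) subr0.
have SE S : state S -> n%:R * S f = \sum_(0 <= i < n) S (u i).
  by move=> SS; rewrite -(stateZ SS)// -(state_sum SS)// -fE.
rewrite -(ler_pM2l n0') mulrDr divff ?gt_eqF// (SE _ SI) (SE _ SL).
(* This pairs each support with the layer below it. *)
have shift (a b : nat -> R) m : a 0%N <= 1 -> (forall i, a i.+1 <= b i) ->
    (forall i, 0 <= b i) -> \sum_(0 <= i < m) a i <= \sum_(0 <= i < m) b i + 1.
  move=> a1 ab b0; case: m => [|m]; first by rewrite !big_geq// add0r.
  rewrite big_nat_recl// addrC lerD// big_nat_recr//= -[leLHS]addr0 lerD//.
  by apply: ler_sum => i _; exact: ab.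
apply: (@le_trans _ _ (\sum_(0 <= i < n) outer L (P i))).
  by apply: ler_sum => i _.
apply: shift => // [|i]; first exact: outer_le1.
by apply: (state_ge0 SL).
Qed.

End riesz.

(** * Flows of periodic Lipschitz vector fields *)

Section calculus.
Context {R : realType}.
Implicit Types (f df w dw : R -> R) (a b t s C : R).

Lemma mean_value f df a b : a <= b ->
  (forall x, a <= x <= b -> is_derive x 1 f (df x)) ->
  exists2 c, a <= c <= b & f b - f a = df c * (b - a).
Proof.
move=> ab fdf; have [||c] := @MVT_segment R f df a b ab.
- by move=> x; rewrite in_itv /= => /andP[/ltW ax /ltW xb]; apply: fdf; rewrite ax.
- apply: derivable_within_continuous => x; rewrite in_itv /= => xab.
  by have [] := fdf x xab.
- by rewrite in_itv /=; exists c.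
Qed.

(** [w s * expR (- C * s)] is nonincreasing. *)
Lemma gronwall_ge0 w dw C t : (forall s, is_derive s 1 w (dw s)) ->
  (forall s, dw s <= C * w s) -> 0 <= t -> w t <= w 0 * expR (C * t).
Proof.
move=> wdw dwC t0.
pose v s := w s * expR (- C * s).
have vdv s : is_derive s 1 v (dw s * expR (- C * s) - C * w s * expR (- C * s)).
  have -> : v = w * (expR \o (fun s => - C * s)) by [].
  apply: (@is_derive_eq _ _ _ _ _ _ _ (w s *: (expR (- C * s) * - C) +
    expR (- C * s) *: dw s)); last by rewrite /GRing.scale /=; ring.
  apply: is_deriveM; apply: is_derive1_comp.
  apply: (is_derive_eq (is_deriveZ (- C) (is_derive_id s (1 : R)))).
  by rewrite /GRing.scale /= mulr1.
have [c _ vE] := mean_value t0 (fun s _ => vdv s).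
have : v t - v 0 <= 0.
  rewrite vE subr0 mulr_le0_ge0// -mulrBl mulr_le0_ge0 ?expR_ge0//.
  by rewrite subr_le0.
rewrite subr_le0 /v mulr0 expR0 mulr1 mulNr expRN => h.
by rewrite -ler_pdivrMr ?expR_gt0.
Qed.

Lemma gronwall w dw C t : (forall s, is_derive s 1 w (dw s)) ->
  (forall s, `|dw s| <= C * w s) -> w t <= w 0 * expR (C * `|t|).
Proof.
move=> wdw dwC; have [t0|t0] := leP 0 t.
  rewrite ger0_norm//; apply: gronwall_ge0 => // s.
  by rewrite (le_trans _ (dwC s))// ler_norm.
rewrite ltr0_norm//; have := @gronwall_ge0 (w \o -%R) (fun s => - dw (- s)) C (- t).
rewrite /= opprK oppr0; apply; last by rewrite oppr_ge0 ltW.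
- move=> s.
  apply: (is_derive_eq (is_derive1_comp (wdw (- s)) (is_deriveNid s (1 : R)))).
  by rewrite mulrN1.
- move=> s; apply: le_trans (dwC (- s)).
  by rewrite -normrN ler_norm.
Qed.

Lemma is_derive_row d (u : R -> 'rV[R]_d) (l : 'rV[R]_d) t :
  is_derive t (1 : R) u l -> forall i, is_derive t 1 (fun s => u s ord0 i) (l ord0 i).
Proof.
move=> [du ul] i; have dui := (derivable_mxP u t 1).1 du.
by apply: DeriveDef; [exact: dui|rewrite -ul derive_mx// mxE].
Qed.

End calculus.

Section lipschitz.
Context {R : realType} {d : nat}.
Implicit Types (f : 'rV[R]_d -> R) (x y v : 'rV[R]_d) (s r : R).

Lemma is_derive_line f x v s : derivable f (x + s *: v) v ->
  is_derive s 1 (fun r => f (x + r *: v)) ('D_v f (x + s *: v)).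
Proof.
have E : (fun h => h^-1 *: (((fun r : R => f (x + r *: v)) \o shift s) (h *: 1) -
    f (x + s *: v))) =
    (fun h : R => h^-1 *: ((f \o shift (x + s *: v)) (h *: v) - f (x + s *: v))).
  apply/funext => h /=; congr (_ *: (f _ - _)).
  by rewrite scalerDl [h *: 1]mulr1 addrCA.
move=> dfx; apply: DeriveDef; first by rewrite /derivable E.
by rewrite /derive E.
Qed.

Lemma periodic_derive f v : Defs.periodic f -> Defs.periodic (fun x => 'D_v f x).
Proof.
move=> pf x k; rewrite /derive; congr (lim _).
apply/seteqP; split; apply: near_eq_cvg; apply: nearW => h /=;
  by rewrite !addrA !pf.
Qed.

(** Moving from [y] to [x] one coordinate at a time reduces the estimate to
    the mean value theorem along the coordinate axes. *)
Lemma C1_sharp_lipschitz f : C1_sharp f -> exists2 K, 0 <= K &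
  forall x y, `|f x - f y| <= K * \sum_i `|x ord0 i - y ord0 i|.
Proof.
move=> [[cf pf] df].
have /choice[M MP] (i : 'I_d) : exists M, 0 < M /\
    forall x, `|'D_(delta_mx ord0 i) f x| <= M.
  have [_ cdf] := df i.
  have [|M M0 fM] := @C0_sharp_bounded R d (fun x => 'D_(delta_mx ord0 i) f x).
    by split => //; exact: periodic_derive.
  by exists M.
have M0 i : 0 <= M i by have [/ltW] := MP i.
exists (\sum_i M i) => [|x y]; first by rewrite sumr_ge0.
pose z (k : nat) : 'rV[R]_d := \row_(j < d) if (j < k)%N then x ord0 j else y ord0 j.
have -> : f x - f y = \sum_(0 <= k < d) (f (z k.+1) - f (z k)).
  rewrite telescope_sumr//; congr (f _ - f _); apply/rowP => j; rewrite mxE.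
    by rewrite ltn_ord.
  by rewrite ltn0.
rewrite big_mkord mulr_sumr (le_trans (ler_norm_sum _ _ _))//.
apply: ler_sum => k _.
have zS : z k.+1 = z k + (x ord0 k - y ord0 k) *: delta_mx ord0 k.
  apply/rowP => j; rewrite !mxE eqxx /= ltnS leq_eqVlt.
  have [->|jk] := eqVneq j k; first by rewrite eqxx ltnn /= mulr1 addrC subrK.
  by rewrite (negbTE (jk : val j != val k)) /= mulr0 addr0.
have step (r : R) (a : 'rV[R]_d) :
    `|f (a + r *: delta_mx ord0 k) - f a| <= M k * `|r|.
  pose phi s := f (a + s *: delta_mx ord0 k).
  have phi0 : f a = phi 0 by rewrite /phi scale0r addr0.
  have dphi s : is_derive s 1 phi ('D_(delta_mx ord0 k) f (a + s *: delta_mx ord0 k)).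
    by apply: is_derive_line; exact: (df k).1.
  have [_ MD] := MP k.
  rewrite phi0 -/(phi r); have [r0|/ltW r0] := leP 0 r.
    have [c _ ->] := mean_value r0 (fun s _ => dphi s).
    by rewrite normrM subr0 ler_wpM2r.
  have [c _] := mean_value r0 (fun s _ => dphi s).
  by rewrite distrC => ->; rewrite normrM sub0r normrN ler_wpM2r.
rewrite zS (le_trans (step _ _))// ler_wpM2r//.
by rewrite (bigD1 k)//= lerDl sumr_ge0.
Qed.

End lipschitz.

Section flow.
Context {R : realType} {d : nat}.
Variables (b : 'rV[R]_d -> 'rV[R]_d).
Hypothesis hb : forall i : 'I_d, C1_sharp (fun x => b x ord0 i).
Implicit Types (x y : 'rV[R]_d) (u v : R -> 'rV[R]_d) (t s r : R).

Lemma field_lipschitz : exists2 K, 0 <= K &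
  forall x y i, `|b x ord0 i - b y ord0 i| <= K * \sum_j `|x ord0 j - y ord0 j|.
Proof.
have /choice[K KP] i : exists K, 0 <= K /\ forall x y,
    `|b x ord0 i - b y ord0 i| <= K * \sum_j `|x ord0 j - y ord0 j|.
  by have [K K0 KP] := C1_sharp_lipschitz (hb i); exists K.
exists (\sum_i K i) => [|x y i]; first by rewrite sumr_ge0// => i _; have [] := KP i.
have [_ /(_ x y) /le_trans] := KP i; apply.
rewrite ler_wpM2r ?sumr_ge0// (bigD1 i)//= lerDl sumr_ge0// => j _.
by have [] := KP j.
Qed.

Lemma field_bounded : exists2 M, 0 < M & forall x i, `|b x ord0 i| <= M.
Proof.
have /choice[M MP] i : exists M, 0 < M /\ forall x, `|b x ord0 i| <= M.
  by have [M M0 MP] := C0_sharp_bounded (hb i).1; exists M.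
have M0 i : 0 <= M i by have [/ltW] := MP i.
exists (1 + \sum_i M i) => [|x i]; first by rewrite ltr_pwDl// sumr_ge0.
have [_ /(_ x) /le_trans] := MP i; apply.
by rewrite (bigD1 i)//= addrCA lerDl addr_ge0// sumr_ge0.
Qed.

Definition sqdist x y : R := \sum_i (x ord0 i - y ord0 i) ^+ 2.

Lemma coord_le_sqdist x y i : (x ord0 i - y ord0 i) ^+ 2 <= sqdist x y.
Proof.
by rewrite /sqdist (bigD1 i)//= lerDl sumr_ge0// => j _; exact: sqr_ge0.
Qed.

Lemma sqdist_eq0 x y : sqdist x y <= 0 -> x = y.
Proof.
move=> xy; apply/rowP => i; apply/eqP; rewrite -subr_eq0 -sqrf_eq0 eq_le sqr_ge0 andbT.
exact: le_trans (coord_le_sqdist x y i) xy.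
Qed.

Definition integral_curve u :=
  forall t i, is_derive t 1 (fun s => u s ord0 i) (b (u t) ord0 i).

(** Gronwall's inequality for the squared Euclidean distance, which is
    differentiable, unlike the norm of the space. *)
Lemma integral_curve_sqdist : exists C, forall u v t,
  integral_curve u -> integral_curve v ->
  sqdist (u t) (v t) <= sqdist (u 0) (v 0) * expR (C * `|t|).
Proof.
have [K K0 lipb] := field_lipschitz.
exists (2 * K * d%:R * d%:R) => u v t hu hv.
pose D i s := u s ord0 i - v s ord0 i.
pose B i s := b (u s) ord0 i - b (v s) ord0 i.
apply: (@gronwall _ (fun s => sqdist (u s) (v s))
  (fun s => \sum_i 2 * (D i s * B i s))) => s.
  have -> : (fun s => sqdist (u s) (v s)) = \sum_i (D i * D i).
    apply/funext => r; rewrite fct_sumE; apply: eq_bigr => i _.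
    by rewrite expr2.
  apply: is_derive_sum => i.
  have dD : is_derive s 1 (D i) (B i s) by apply: is_deriveB; [exact: hu|exact: hv].
  apply: (is_derive_eq (is_deriveM dD dD)).
  by rewrite /GRing.scale /=; ring.
set w := sqdist _ _.
have Dw i j : `|D i s| * `|D j s| <= w.
  have := coord_le_sqdist (u s) (v s) i; have := coord_le_sqdist (u s) (v s) j.
  rewrite -/w -/(D i s) -/(D j s) -(real_normK (num_real (D i s))).
  rewrite -(real_normK (num_real (D j s))).
  by have := sqr_ge0 (`|D i s| - `|D j s|); rewrite sqrrB; nra.
rewrite (le_trans (ler_norm_sum _ _ _))//.
have -> : 2 * K * d%:R * d%:R * w = \sum_(i < d) 2 * K * d%:R * w.
  by rewrite sumr_const card_ord -[RHS]mulr_natr; ring.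
apply: ler_sum => i _; rewrite !normrM (ger0_norm (ler0n R 2)) -!mulrA ler_wpM2l//.
apply: (@le_trans _ _ (`|D i s| * (K * \sum_j `|D j s|))).
  by rewrite ler_wpM2l//; exact: lipb.
rewrite mulrCA ler_wpM2l// mulr_sumr.
have -> : d%:R * w = \sum_(j < d) w by rewrite mulr_natl sumr_const card_ord.
by apply: ler_sum => j _.
Qed.

Lemma integral_curve_unique u v : integral_curve u -> integral_curve v ->
  u 0 = v 0 -> u =1 v.
Proof.
move=> hu hv uv0 t; have [C hC] := integral_curve_sqdist.
apply: sqdist_eq0; rewrite (le_trans (hC u v t hu hv))// uv0.
rewrite /sqdist big1 ?mul0r// => i _.
by rewrite subrr expr0n.
Qed.

Variables (X : R -> 'rV[R]_d -> 'rV[R]_d).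
Hypothesis hX : is_flow b X.

Lemma flow0 x : X 0 x = x.
Proof. by have [] := hX x. Qed.

Lemma flow_integral_curve x : integral_curve (fun t => X t x).
Proof. by move=> t i; apply: is_derive_row; have [_] := hX x. Qed.

Lemma flowD t s x : X (t + s) x = X t (X s x).
Proof.
apply: (@integral_curve_unique (fun t => X (t + s) x) (fun t => X t (X s x))).
- move=> r i; have dX := @flow_integral_curve x (r + s) i.
  have := @is_derive1_comp _ _ (shift s) r _ _ dX (is_derive_shift r (1 : R) s).
  by rewrite mulr1.
- exact: flow_integral_curve.
- by rewrite add0r flow0.
Qed.

Lemma flow_translate t x (k : 'rV[int]_d) :
  X t (x + map_mx intr k) = X t x + map_mx intr k.
Proof.
apply: (@integral_curve_unique (fun t => X t (x + map_mx intr k))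
  (fun t => X t x + map_mx intr k)).
- exact: flow_integral_curve.
- move=> s i; rewrite ((hb i).1.2 (X s x) k).
  have -> : (fun r => (X r x + map_mx intr k) ord0 i) =
      (fun r => X r x ord0 i) + cst ((map_mx intr k : 'rV[R]_d) ord0 i).
    by apply/funext => r; rewrite mxE.
  have dX := @flow_integral_curve x s i.
  apply: (is_derive_eq (is_deriveD dX (is_derive_cst _ s (1 : R)))).
  by rewrite addr0.
- by rewrite !flow0.
Qed.

(** Gronwall's inequality makes [X t] Lipschitz for the Euclidean distance, and
    the squared distance is continuous. *)
Lemma flow_continuous t : continuous (X t).
Proof.
have [C hC] := integral_curve_sqdist.
pose E := expR (C * `|t|); have E0 : 0 < E by exact: expR_gt0.
move=> x; apply: (@cvg_row _ _ _ (nbhs x) (nbhs_filter x)) => i.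
have sq0 : sqdist x y @[y --> x] --> (0 : R).
  have -> : (0 : R) = \sum_(j < d) 0 by rewrite big1.
  apply: (@cvg_big _ _ _ _ _ (@add_continuous _) _ (nbhs x) _ _ _
    (nbhs_filter x)) => j _.
  have -> : (0 : R) = (x ord0 j - x ord0 j) * (x ord0 j - x ord0 j)
    by rewrite subrr mul0r.
  have cj : {for x, continuous (fun y : 'rV[R]_d => x ord0 j - y ord0 j)}.
    apply: (@continuousB _ _ _ (fun=> x ord0 j) (fun y => y ord0 j) x).
      exact: cst_continuous.
    exact: coord_continuous.
  exact: (cvgM cj cj).
apply/cvgrPdist_lt => e e0; near=> y.
have : sqdist x y < e ^+ 2 / E.
  near: y; apply: (@cvgr_lt _ _ _ (nbhs_filter x) _ _ sq0).
  by rewrite divr_gt0// exprn_gt0.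
rewrite ltr_pdivlMr// => xy.
rewrite -(ltr_pXn2r (n := 2)) ?nnegrE ?(ltW e0)//.
rewrite real_normK ?num_real//; apply: le_lt_trans xy.
apply: le_trans (coord_le_sqdist (X t x) (X t y) i) _.
rewrite -{2}(flow0 x) -{2}(flow0 y).
exact: (hC (fun t => X t x) (fun t => X t y) t (@flow_integral_curve x)
  (@flow_integral_curve y)).
Unshelve. all: by end_near. Qed.

Lemma C0_sharp_flow t (f : 'rV[R]_d -> R) : C0_sharp f ->
  C0_sharp (fun y => f (X t y)).
Proof.
move=> [cf pf]; split=> [x|x k]; last by rewrite flow_translate pf.
by apply: (@continuous_comp _ _ _ (X t) f); [exact: flow_continuous|exact: cf].
Qed.

Lemma C0_sharp_displacement t i : C0_sharp (fun y => X t y ord0 i - y ord0 i).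
Proof.
split=> [x|x k]; last first.
  by rewrite flow_translate !mxE opprD addrACA subrr addr0.
apply: (@continuousB _ _ _ (fun y => X t y ord0 i) (fun y => y ord0 i) x);
  last exact: coord_continuous.
apply: (@continuous_comp _ _ _ (X t) (fun y : 'rV[R]_d => y ord0 i)).
  exact: flow_continuous.
exact: coord_continuous.
Qed.

Lemma displacement_le : exists2 M, 0 < M & forall t x i, 0 <= t ->
  `|X t x ord0 i - x ord0 i| <= M * t.
Proof.
have [M M0 bM] := field_bounded; exists M => // t x i t0.
have [c _ XE] := mean_value t0 (fun s _ => flow_integral_curve x s i).
by move: XE; rewrite flow0 subr0 => ->; rewrite normrM (ger0_norm t0) ler_wpM2r.
Qed.

(** The orbit of [x] stays at distance [O(t)] from [x] up to time [t], so that
    the Lipschitz field changes by [O(t)] along it. The constant does not depend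
    on [x], which lets the expansion be averaged by a state. *)
Lemma displacement_expansion : exists2 C, 0 <= C & forall t x i, 0 <= t ->
  `|X t x ord0 i - x ord0 i - t * b x ord0 i| <= C * t ^+ 2.
Proof.
have [M M0 XM] := displacement_le; have [K K0 lipb] := field_lipschitz.
exists (K * d%:R * M); first by rewrite !mulr_ge0// ltW.
move=> t x i t0.
have [c /andP[c0 ct] XE] := mean_value t0 (fun s _ => flow_integral_curve x s i).
move: XE; rewrite flow0 subr0 => ->; rewrite [t * _]mulrC -mulrBl normrM (ger0_norm t0).
rewrite expr2 mulrA ler_wpM2r// (le_trans (lipb _ _ _))// -!mulrA ler_wpM2l//.
have -> : d%:R * (M * t) = \sum_(j < d) M * t by rewrite mulr_natl sumr_const card_ord.
apply: ler_sum => j _; rewrite (le_trans (XM c x j c0))// ler_wpM2l// ltW//.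
Qed.

End flow.

(** * Ultrafilter limits of states *)

Section ultrafilters.
Context {R : realType}.

Lemma ultra_bounded_cvg (T : Type) (F : set_system T) (g : T -> R) M :
  UltraFilter F -> (\forall t \near F, `|g t| <= M) -> cvg (g @ F).
Proof.
move=> UF gM; have PF : ProperFilter F := @ultra_proper _ _ UF.
have gMF : (g @ F) [set` `[- M, M]].
  by move: gM; apply: filterS => t; rewrite /= in_itv /= ler_norml.
have [p [_ pc]] :=
  @segment_compact R (- M) M (g @ F) (fmap_proper_filter g PF) gMF.
apply/cvg_ex; exists p => U Up /=.
have [//|FU] := in_ultra_setVsetC (g @^-1` U) UF.
by have [r [/= nUr Ur]] : ~` U `&` U !=set0 by exact: pc.
Qed.

(** This lets convergence be tested along filters for which all limits of bounded
    quantities exist. *)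
Lemma cvg_ultra (T : Type) (U : topologicalType) (F : set_system T)
    (f : T -> U) (l : U) : ProperFilter F ->
  (forall G, UltraFilter G -> F `<=` G -> f @ G --> l) -> f @ F --> l.
Proof.
move=> FF fl V Vl /=; apply: contrapT => nFV.
have PW : ProperFilter (within (~` (f @^-1` V)) F).
  apply: Build_ProperFilter_ex => B FB; apply: contrapT => nB; apply: nFV.
  move: FB; rewrite /within /= => FB; apply: filterS FB => t Bt.
  by apply: contrapT => Vt; apply: nB; exists t; exact: Bt.
have [G [UG WG]] := ultraFilterLemma PW.
have FG : F `<=` G by move=> B FB; apply: WG; exact: filterS FB.
have GV : G (f @^-1` V) by exact: (fl G UG FG).
have GnV : G (~` (f @^-1` V)) by apply: WG; exact: withinT.
have PG : ProperFilter G := @ultra_proper _ _ UG.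
by have [t [Vt]] := filter_ex (@filterI _ G _ _ _ GV GnV); exact.
Qed.

Context {d : nat} (T : Type) (F : set_system T).
Context {UF : UltraFilter F}.
Variable Ls : T -> ('rV[R]_d -> R) -> R.
Hypothesis SLs : \forall t \near F, state (Ls t).

(** Along an ultrafilter all continuous functions converge simultaneously, so
    that this gives the weak-star compactness of states with no extraction of
    subsequences. *)
Definition ultralimit (f : 'rV[R]_d -> R) : R := lim (Ls t f @[t --> F]).

Let PF : ProperFilter F := @ultra_proper _ _ UF.
#[local] Existing Instance PF.

Lemma ultralimit_cvg f : C0_sharp f -> Ls t f @[t --> F] --> ultralimit f.
Proof.
move=> Cf; have [M M0 fM] := C0_sharp_bounded Cf.
apply: (@ultra_bounded_cvg _ F (Ls ^~ f) M) => //.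
by apply: filterS SLs => t St; exact: state_norm_le.
Qed.

Lemma ultralimit_eq f (g : T -> R) l :
  (\forall t \near F, Ls t f = g t) -> g t @[t --> F] --> l -> ultralimit f = l.
Proof.
move=> fg gl; apply: cvg_lim => //.
by apply: cvg_trans gl; apply: near_eq_cvg; apply: filterS fg => t ->.
Qed.

Lemma ultralimit_state : state ultralimit.
Proof.
have C1 : C0_sharp (fun _ : 'rV[R]_d => (1 : R)) by exact: C0_sharp_cst.
split.
- move=> f g Cf Cg.
  apply: (@ultralimit_eq _ (fun t => Ls t f + Ls t g)).
  + by apply: filterS SLs => t St; exact: stateD.
  + by apply: cvgD; exact: ultralimit_cvg.
- move=> c f Cf; apply: (@ultralimit_eq _ (fun t => c * Ls t f)).
  + by apply: filterS SLs => t St; exact: stateZ.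
  + by apply: cvgM; [exact: cvg_cst|exact: ultralimit_cvg].
- move=> f Cf f0; apply: (limr_ge (ultralimit_cvg Cf)).
  by apply: filterS SLs => t St; exact: state_ge0.
- apply: (@ultralimit_eq _ (fun=> 1)); last exact: cvg_cst.
  by apply: filterS SLs => t St; exact: state1.
Qed.

End ultrafilters.

(** * Time averages along an orbit *)

Section primitives.
Context {R : realType}.
Implicit Types (g G H : R -> R).

Definition is_primitive g G :=
  G 0 = 0 /\ forall t : R, 0 <= t -> is_derive t (1 : R) G (g t).

Lemma primitive_exists g : continuous g -> exists G, is_primitive g G.
Proof.
(* The lower bound [-1] makes the derivative at [0] two-sided. *)
move=> cg; pose F t := (\int[lebesgue_measure]_(s in `[(-1 : R), t]) g s)%R.
exists (fun t => F t - F 0); split=> [|t t0]; first by rewrite subrr.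
have ig : lebesgue_measure.-integrable `[(-1 : R), t + 1] (EFin \o g).
  apply: continuous_compact_integrable; first exact: segment_compact.
  exact: continuous_subspaceT.
have t1 : t < t + 1 by rewrite ltrDl.
have tm1 : -1 < t by rewrite (lt_le_trans _ t0)// ltrN10.
have [dF F'] := continuous_FTC1_closed t1 ig tm1 (cg t).
have dF' : is_derive t (1 : R) F (g t).
  by apply: DeriveDef; [exact: dF|rewrite -F' derive1E].
by have := is_deriveB dF' (is_derive_cst (F 0) t (1 : R)); rewrite subr0.
Qed.

Lemma primitive_unique g G H t : is_primitive g G -> is_primitive g H ->
  0 <= t -> G t = H t.
Proof.
move=> [G0 dG] [H0 dH] t0; apply/eqP; rewrite -subr_eq0; apply/eqP.
have dGH s : 0 <= s <= t -> is_derive s (1 : R) (fun r => G r - H r) 0.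
  move=> /andP[s0 _].
  by have := is_deriveB (dG s s0) (dH s s0); rewrite subrr.
have [c _] := mean_value t0 dGH.
by rewrite G0 H0 subrr subr0 mul0r.
Qed.

Definition primitive g : R -> R := get (is_primitive g).

Lemma primitiveP g : continuous g -> is_primitive g (primitive g).
Proof. by move=> /primitive_exists; exact: getPex. Qed.

Lemma primitiveE g G t : continuous g -> is_primitive g G -> 0 <= t ->
  primitive g t = G t.
Proof. by move=> /primitiveP; exact: primitive_unique. Qed.

Lemma primitive_increment g M s t : continuous g -> (forall r, `|g r| <= M) ->
  0 <= s -> s <= t -> `|primitive g t - primitive g s| <= M * (t - s).
Proof.
move=> /primitiveP[_ dP] gM s0 st.
have [c _ ->] := mean_value st (fun r srt =>
  dP r (le_trans s0 (andP srt).1)).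
by rewrite normrM (ger0_norm (x := t - s)) ?subr_ge0// ler_wpM2r// subr_ge0.
Qed.

End primitives.

Section time_average.
Context {R : realType} {d : nat}.
Variables (b : 'rV[R]_d -> 'rV[R]_d) (X : R -> 'rV[R]_d -> 'rV[R]_d).
Hypothesis hb : forall i : 'I_d, C1_sharp (fun x => b x ord0 i).
Hypothesis hX : is_flow b X.
Variable x : 'rV[R]_d.
Implicit Types (f : 'rV[R]_d -> R).

Lemma continuous_orbit : continuous (fun t => X t x).
Proof.
move=> t; apply: (@cvg_row _ _ _ (nbhs t) (nbhs_filter t)) => i.
have [dX _] := flow_integral_curve hX x t i.
exact/differentiable_continuous/derivable1_diffP.
Qed.

Lemma continuous_along_orbit f : C0_sharp f -> continuous (fun s => f (X s x)).
Proof.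
move=> [cf _] t.
apply: (@continuous_comp _ _ _ (fun s => X s x) f).
  exact: (@continuous_orbit t).
exact: cf.
Qed.

(** The integral of [f] over the orbit segment is taken as a primitive, so that
    linearity, the effect of a time shift and the average of the field itself
    all follow from the uniqueness of primitives. *)
Definition time_average (t : R) f : R := primitive (fun s => f (X s x)) t / t.

Lemma time_average_state t : 0 < t -> state (time_average t).
Proof.
move=> t0; have t0' := ltW t0; split.
- move=> f g Cf Cg; rewrite /time_average -mulrDl; congr (_ / _).
  have [f0 df] := primitiveP (continuous_along_orbit Cf).
  have [g0 dg] := primitiveP (continuous_along_orbit Cg).
  apply: (@primitiveE _ _ (primitive (fun s => f (X s x)) +
    primitive (fun s => g (X s x)))) => //.
    exact: (continuous_along_orbit (C0_sharpD Cf Cg)).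
  split=> [|s s0]; first by rewrite fctE f0 g0 addr0.
  exact: (is_deriveD (df s s0) (dg s s0)).
- move=> c f Cf; rewrite /time_average mulrA; congr (_ / _).
  have [f0 df] := primitiveP (continuous_along_orbit Cf).
  apply: (@primitiveE _ _ (c \*: primitive (fun s => f (X s x)))) => //.
    exact: (continuous_along_orbit (C0_sharpZ c Cf)).
  split=> [|s s0]; first by rewrite /= f0 scaler0.
  exact: (is_deriveZ c (df s s0)).
- move=> f Cf f0; rewrite /time_average divr_ge0//.
  have [F0 dF] := primitiveP (continuous_along_orbit Cf).
  have [c _] := mean_value t0' (fun s st => dF s (andP st).1).
  by rewrite F0 !subr0 => ->; rewrite mulr_ge0.
- rewrite /time_average (@primitiveE _ _ id) ?divff ?gt_eqF//.
    exact: cst_continuous.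
  by split=> // s _; exact: is_derive_id.
Qed.

Lemma time_average_field t i : 0 < t ->
  time_average t (fun y => b y ord0 i) = (X t x ord0 i - x ord0 i) / t.
Proof.
move=> t0; congr (_ / _).
apply: (@primitiveE _ _ (fun t => X t x ord0 i - x ord0 i)); last exact: ltW.
  exact: (continuous_along_orbit (hb i).1).
split=> [|s _]; first by rewrite (flow0 hX) subrr.
have dX := flow_integral_curve hX x s i.
by have := is_deriveB dX (is_derive_cst (x ord0 i) s (1 : R)); rewrite subr0.
Qed.

Lemma time_average_flow f h t M : C0_sharp f -> (forall y, `|f y| <= M) ->
  0 <= h -> 0 < t ->
  `|time_average t (fun y => f (X h y)) - time_average t f| <= 2 * M * h / t.
Proof.
move=> Cf fM h0 t0; have t0' := ltW t0.
have cf := continuous_along_orbit Cf; have [P0 dP] := primitiveP cf.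
set P := primitive (fun s => f (X s x)) in P0 dP *.
have -> : time_average t (fun y => f (X h y)) = (P (t + h) - P h) / t.
  congr (_ / _).
  apply: (@primitiveE _ _ (fun t => P (t + h) - P h)) => //.
    exact: (continuous_along_orbit (C0_sharp_flow hb hX h Cf)).
  split=> [|s s0]; first by rewrite add0r subrr.
  rewrite -(flowD hb hX) addrC.
  have dPh := dP (s + h) (addr_ge0 s0 h0).
  have := @is_derive1_comp _ P (shift h) s _ _ dPh (is_derive_shift s (1 : R) h).
  move=> /is_deriveB /(_ (is_derive_cst (P h) s (1 : R))).
  by rewrite mulr1 subr0.
rewrite /time_average -/P -mulrBl normrM (gtr0_norm (x := t^-1)) ?invr_gt0//.
rewrite ler_pM2r ?invr_gt0//.
have h1 : `|P (t + h) - P t| <= M * h.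
  rewrite -[h in leRHS](addKr t) [- t + _]addrC.
  by apply: primitive_increment => //; rewrite lerDl.
have h2 : `|P h - P 0| <= M * h.
  by rewrite -[h in leRHS]subr0; apply: primitive_increment.
have -> : P (t + h) - P h - P t = P (t + h) - P t - (P h - P 0) by rewrite P0; ring.
rewrite (le_trans (ler_normB _ _))//.
have -> : 2 * M * h = M * h + M * h by ring.
exact: lerD.
Qed.

Definition invariant_state L := state L /\
  forall t f, C0_sharp f -> L (fun y => f (X t y)) = L f.

(** Over a long time, shifting an orbit segment by [h] changes it only near its
    ends. Negative shifts follow from positive ones by the group law. *)
Lemma time_average_limit_invariant (F : set_system R) (UF : UltraFilter F) :
  +oo `<=` F -> invariant_state (ultralimit F time_average).
Proof.
move=> yF.
have Spos : \forall t \near F, 0 < t by apply: yF; exact: nbhs_pinfty_gt.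
have SF : \forall t \near F, state (time_average t).
  by apply: filterS Spos => t; exact: time_average_state.
have PF : ProperFilter F := @ultra_proper _ _ UF.
have inv_ge0 h f : 0 <= h -> C0_sharp f ->
    ultralimit F time_average (fun y => f (X h y)) = ultralimit F time_average f.
  move=> h0 Cf; have [M M0 fM] := C0_sharp_bounded Cf.
  have Cfh : C0_sharp (fun y => f (X h y)) by exact: (C0_sharp_flow hb hX).
  have l1 := ultralimit_cvg (UF := UF) SF Cfh.
  have l2 := ultralimit_cvg (UF := UF) SF Cf.
  apply/eqP; rewrite -subr_eq0; apply/eqP.
  have <- := cvg_lim (@Rhausdorff R) (cvgB l1 l2); apply: cvg_lim => //.
  apply/cvgrPdist_le => e e0.
  have : \forall t \near F, 2 * M * h / e < t.
    by apply: yF; apply: nbhs_pinfty_gt; exact: num_real.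
  apply: filterS2 Spos => t t0 te; rewrite sub0r normrN.
  rewrite (le_trans (time_average_flow Cf fM h0 t0))//.
  by rewrite ler_pdivrMr// -ler_pdivrMl// mulrC ltW.
split; first exact: ultralimit_state.
move=> t f Cf; have [t0|t0] := leP 0 t; first exact: inv_ge0.
have Cft : C0_sharp (fun y => f (X t y)) by exact: (C0_sharp_flow hb hX).
rewrite -(inv_ge0 (- t) _ _ Cft) ?oppr_ge0 ?ltW//.
congr (ultralimit _ _ _); apply/funext => y.
by rewrite -(flowD hb hX) subrr (flow0 hX).
Qed.

End time_average.

(** * The rotation set *)

Section rotation_set.
Context {R : realType} {d : nat}.
Variables (b : 'rV[R]_d -> 'rV[R]_d) (X : R -> 'rV[R]_d -> 'rV[R]_d).
Hypothesis hb : forall i : 'I_d, C1_sharp (fun x => b x ord0 i).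
Hypothesis hX : is_flow b X.

Let bi (i : 'I_d) (x : 'rV[R]_d) : R := b x ord0 i.

(** By the Riesz representation, invariant measures can be replaced by invariant
    states, which are easier to construct and to pass to the limit. *)
Lemma rotation_setP z : rotation_set b X z <->
  exists2 L, invariant_state X L & z = \row_i L (bi i).
Proof.
split=> [[mu [mu1 muX] <-]|[L [SL LX] ->]].
  by exists (torus_integral mu) => //; split => //; exact: torus_integral_state.
have [mu mu1 muL] := riesz_representation SL.
exists mu.
  split=> // t f Cf; rewrite !muL ?LX//.
  exact: (C0_sharp_flow hb hX).
by apply/rowP => i; rewrite !mxE muL//; exact: (hb i).1.
Qed.

(** The Krylov-Bogoliubov argument, along the orbit of the origin. *)
Lemma invariant_state_exists : exists L, invariant_state X L.
Proof.
have [F [UF yF]] := ultraFilterLemma (@proper_pinfty_nbhs R).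
exists (ultralimit F (time_average X 0)).
exact: (time_average_limit_invariant hb hX).
Qed.

Lemma rotation_set_nonempty : rotation_set b X !=set0.
Proof.
have [L LX] := invariant_state_exists.
by exists (\row_i L (bi i)); apply/rotation_setP; exists L.
Qed.

(** An ultrafilter on the rotation set transports to a family of invariant
    states, whose ultralimit is again an invariant state. *)
Lemma rotation_set_compact : compact (rotation_set b X).
Proof.
rewrite compact_ultra => F UF FC; have PF : ProperFilter F := @ultra_proper _ _ UF.
have /choice[Ls LsP] z : exists L, rotation_set b X z ->
    invariant_state X L /\ z = \row_i L (bi i).
  have [/rotation_setP[L LX zL]|nz] := pselect (rotation_set b X z).
    by exists L.
  by exists (fun=> 0).
have SF : \forall z \near F, state (Ls z).
  by apply: filterS FC => z /LsP[[]].
pose L := ultralimit F Ls.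
have Lcvg f : C0_sharp f -> Ls z f @[z --> F] --> L f by exact: ultralimit_cvg.
exists (\row_i L (bi i)); split.
  apply/rotation_setP; exists L => //; split; first exact: ultralimit_state.
  move=> t f Cf; apply: (ultralimit_eq (g := fun z => Ls z f)); last exact: Lcvg.
  by apply: filterS FC => z /LsP[[_ LX] _]; exact: LX.
apply: (@cvg_row _ _ _ F _ id) => i; rewrite mxE.
apply: cvg_trans (Lcvg _ (hb i).1); apply: near_eq_cvg.
apply: filterS FC => z /LsP[_ zE].
by rewrite [in RHS]zE mxE.
Qed.

Lemma rotation_set_convex : convex_set (rotation_set b X).
Proof.
move=> x y l; rewrite !inE => /rotation_setP[L [SL LX] ->].
move=> /rotation_setP[L' [SL' LX'] ->]; apply/rotation_setP.
have l0 : 0 <= l%:num by exact: ge0.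
have l1 : 0 <= 1 - l%:num by rewrite subr_ge0; exact: le1.
exists (fun f => l%:num * L f + (1 - l%:num) * L' f).
  split; last by move=> t f Cf; rewrite LX ?LX'.
  split=> [f g Cf Cg|c f Cf|f Cf f0|].
  - by rewrite (stateD SL)// (stateD SL')//; ring.
  - by rewrite (stateZ SL)// (stateZ SL')//; ring.
  - by rewrite addr_ge0// mulr_ge0//; exact: state_ge0.
  - by rewrite (state1 SL) (state1 SL'); ring.
by apply/rowP => i; rewrite !mxE.
Qed.

(** Each orbit produces an invariant state which averages the field to any
    ultrafilter limit of the mean velocities; if the rotation set is a point,
    all these limits agree. *)
Lemma mean_velocity_cvg zeta : rotation_set b X = [set zeta] ->
  forall x : 'rV[R]_d, t^-1 *: X t x @[t --> +oo] --> zeta.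
Proof.
move=> bz x; apply: cvg_ultra => F UF yF.
have PF : ProperFilter F := @ultra_proper _ _ UF.
have LX := time_average_limit_invariant hb hX x UF yF.
set L := ultralimit F (time_average X x) in LX.
have zE : zeta = \row_i L (bi i).
  have : rotation_set b X (\row_i L (bi i)) by apply/rotation_setP; exists L.
  by rewrite bz => ->.
apply: (@cvg_row _ _ _ F PF) => i; rewrite zE mxE.
have Spos : \forall t \near F, 0 < t by apply: yF; exact: nbhs_pinfty_gt.
have SF : \forall t \near F, state (time_average X x t).
  by apply: filterS Spos => t; exact: (time_average_state hX).
have tinv : t^-1 * x ord0 i @[t --> F] --> 0.
  apply/cvgrPdist_le => e e0.
  have : \forall t \near F, `|x ord0 i| / e < t.
    by apply: yF; apply: nbhs_pinfty_gt; exact: num_real.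
  apply: filterS2 Spos => t t0 te; rewrite sub0r normrN normrM.
  rewrite (gtr0_norm (x := t^-1)) ?invr_gt0// ler_pdivrMl// mulrC.
  by rewrite -ler_pdivrMl// mulrC ltW.
have Lcvg : time_average X x t (bi i) @[t --> F] --> L (bi i).
  exact: (ultralimit_cvg (UF := UF) SF (hb i).1).
have : time_average X x t (bi i) + t^-1 * x ord0 i @[t --> F] --> L (bi i).
  by rewrite -[L _]addr0; exact: cvgD.
apply: cvg_trans; apply: near_eq_cvg; apply: filterS Spos => t t0.
by rewrite (time_average_field hb hX)// mxE /=; field; rewrite gt_eqF.
Qed.

(** By invariance the mean displacement [G t] is additive in [t]. Comparing
    [G 1] with [n * G (1 / n)] shows that it is the mean of the field, and
    comparing it with [G n / n] that it is the mean of the limit velocity. *)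
Lemma rotation_vector_unique (zeta : 'rV[R]_d) :
  (forall x : 'rV[R]_d, t^-1 *: X t x @[t --> +oo] --> zeta) ->
  forall z, rotation_set b X z -> z = zeta.
Proof.
move=> Xz _ [mu [mu1 muX] <-]; apply/rowP => i; rewrite mxE.
have SL := torus_integral_state mu1.
set L := torus_integral mu in muX SL *.
pose disp t y := X t y ord0 i - y ord0 i.
have Cdisp t : C0_sharp (disp t) by exact: (C0_sharp_displacement hb hX).
pose G t := L (disp t).
have GD t s : G (t + s) = G t + G s.
  rewrite /G -(muX s _ (Cdisp t)) -(stateD SL)//; last first.
    exact: (C0_sharp_flow hb hX s (Cdisp t)).
  congr L; apply/funext => y; rewrite /disp (flowD hb hX).
  by rewrite addrA subrK.
have GM n t : G (n.+1%:R * t) = n.+1%:R * G t.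
  elim: n => [|n IH]; first by rewrite !mul1r.
  by rewrite -natr1 !mulrDl !mul1r GD IH.
have Lb : L (bi i) = G 1.
  have [C C0 XC] := displacement_expansion hb hX.
  have Gb n : `|G 1 - L (bi i)| <= C / n.+1%:R.
    have n0 : 0 < n.+1%:R :> R by rewrite ltr0n.
    pose t : R := n.+1%:R^-1; have t0 : 0 <= t by rewrite invr_ge0.
    have -> : G 1 = n.+1%:R * G t by rewrite -GM divff// gt_eqF.
    have -> : L (bi i) = n.+1%:R * (t * L (bi i)) by rewrite mulVKf// gt_eqF.
    rewrite -mulrBr -(stateZ SL t (hb i).1) -(stateB SL)//; last first.
      exact: C0_sharpZ (hb i).1.
    rewrite normrM gtr0_norm// -ler_pdivlMl//.
    have -> : n.+1%:R^-1 * (C / n.+1%:R) = C * t ^+ 2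
      by rewrite /t; field; rewrite gt_eqF.
    apply: (state_norm_le SL) => [|y]; last exact: XC.
    by apply: C0_sharpB => //; exact: C0_sharpZ (hb i).1.
  apply/eqP; rewrite eq_sym -subr_eq0 -normr_le0.
  apply/ler_addgt0Pr => e e0; rewrite add0r.
  have [N _ /(_ N.+1 (leqnSn N)) /= CN] := nbhs_infty_ger (C / e).
  rewrite (le_trans (Gb N))// ler_pdivrMr ?ltr0n//.
  by rewrite -ler_pdivrMl// mulrC.
rewrite Lb.
have [M M0 XM] := displacement_le hb hX.
pose v (n : nat) y : R := n.+1%:R^-1 * disp n.+1%:R y.
have Cv n : C0_sharp (v n) by exact: C0_sharpZ.
have vI n : (\int[mu]_(y in @cube R d) (v n y)%:E)%E = (G 1)%:E.
  have Iv := C0_sharp_integrable mu (Cv n).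
  rewrite -(fineK (integrable_fin_num measurable_cube Iv)); congr (_%:E).
  have -> : G 1 = n.+1%:R^-1 * G n.+1%:R.
    by have := GM n 1; rewrite mulr1 => ->; rewrite mulKf// gt_eqF.
  exact: (stateZ SL).
have v_cvg y : v n y @[n --> \oo] --> zeta ord0 i.
  have n_oo : n.+1%:R @[n --> \oo] --> (+oo : set_system R).
    apply/cvgryPge => A; near=> n.
    apply: (@le_trans _ _ n%:R); last by rewrite ler_nat.
    by near: n; exact: nbhs_infty_ger.
  have h1 : n.+1%:R^-1 * X n.+1%:R y ord0 i @[n --> \oo] --> zeta ord0 i.
    have := cvg_comp _ _ n_oo (Xz y).
    move=> /(cvg_comp _ _)/(_ (@coord_continuous _ _ _ ord0 i zeta)).
    apply: cvg_trans; apply: near_eq_cvg; apply: nearW => n.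
    by rewrite /= mxE.
  have h2 : n.+1%:R^-1 * y ord0 i @[n --> \oo] --> 0.
    rewrite -(mul0r (y ord0 i)); apply: cvgM; last exact: cvg_cst.
    exact: cvg_harmonic.
  have : n.+1%:R^-1 * X n.+1%:R y ord0 i - n.+1%:R^-1 * y ord0 i @[n --> \oo]
      --> zeta ord0 i by rewrite -[zeta _ _]subr0; exact: cvgB.
  apply: cvg_trans; apply: near_eq_cvg; apply: nearW => n.
  by rewrite /v /disp mulrBr.
have v_le n y : `|v n y| <= M.
  rewrite normrM gtr0_norm ?invr_gt0// ler_pdivrMl// mulrC.
  exact: XM.
have Icvg : ((\int[mu]_(y in @cube R d) (v n y)%:E)%E @[n --> \oo] -->
    \int[mu]_(y in @cube R d) (zeta ord0 i)%:E)%E.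
  apply: (@dominated_cvg _ _ _ mu _ measurable_cube (fun n y => (v n y)%:E)
    (fun=> (zeta ord0 i)%:E) (fun=> M%:E)).
  - move=> n; exact: (measurable_int _ (C0_sharp_integrable mu (Cv n))).
  - by move=> y _; apply: cvg_EFin; [exact: nearW|exact: v_cvg].
  - by [].
  - exact: (C0_sharp_integrable mu (C0_sharp_cst M)).
  - by move=> n y _; rewrite lee_fin.
have zI : (\int[mu]_(y in @cube R d) (zeta ord0 i)%:E = (zeta ord0 i)%:E)%E.
  rewrite (integral_cst mu measurable_cube).
  by rewrite [X in (_ * X)%E](mu1 : _ = 1%E) mule1.
move: Icvg; rewrite zI; under eq_fun do rewrite vI.
by move=> /cvg_lim; rewrite lim_cst// => /(_ (@ereal_hausdorff R))[].
Unshelve. all: by end_near. Qed.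

End rotation_set.

Unset Implicit Arguments.

Theorem theorem2p1 (R : realType) (d : nat) (hd : (1 <= d)%N)
    (b : 'rV[R]_d -> 'rV[R]_d)
    (hb : forall i : 'I_d, C1_sharp (fun x => b x ord0 i))
    (X : R -> 'rV[R]_d -> 'rV[R]_d) (hX : is_flow b X) :
  [/\ invariant_measures X !=set0,
      rotation_set b X !=set0,
      compact (rotation_set b X),
      convex_set (rotation_set b X) &
      forall zeta : 'rV[R]_d,
        rotation_set b X = [set zeta] <->
        forall x : 'rV[R]_d, t^-1 *: X t x @[t --> +oo] --> zeta].
Proof.
have ne := rotation_set_nonempty hb hX.
split=> [|//|||zeta].
- by have [_ [mu muX _]] := ne; exists mu.
- exact: rotation_set_compact.
- exact: rotation_set_convex.
- split=> [|Xz]; first exact: mean_velocity_cvg.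
  have zP := rotation_vector_unique hb hX Xz.
  apply/seteqP; split=> [z /zP//|_ ->].
  by have [z bz] := ne; rewrite -(zP z bz).
Qed.
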